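(* Let $P$ be a $3$-dimensional prism or pyramid. Then $m_{\mathcal{P}}(P)=3$.
   Context: A polytope is a bounded intersection of finitely many closed halfspaces. A $3$-dimensional polytope $P\subset\mathbb{R}^3$ is a pyramid (respectively prism) if there exist a $2$-dimensional polytope $Q\subset\mathbb{R}^3$ and $v\in\mathbb{R}^3$ such that $P=\mathrm{conv}\{Q,v\}$ (respectively $P=Q+\mathrm{conv}\{0,v\}=\{q+\lambda v : q\in Q,\ 0\le\lambda\le1\}$). For a $3$-dimensional polytope $P\subset\mathbb{R}^3$, $m_{\mathcal{P}}(P)$ denotes the minimal number $l$ of polynomials $\mathfrak{p}_1,\dots,\mathfrak{p}_l\in\mathbb{R}[x_1,x_2,x_3]$ such that $P=\{x\in\mathbb{R}^3 : \mathfrak{p}_1(x)\ge0,\dots,\mathfrak{p}_l(x)\ge0\}$. *)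

(* Defs.v *)
From HB Require Import structures.
From mathcomp Require Import all_boot all_order all_algebra.
From mathcomp.multinomials Require mpoly.
From mathcomp Require Import all_classical all_reals.
From mathcomp Require Import topology normedtype.

Set Implicit Arguments.
Unset Strict Implicit.
Unset Printing Implicit Defensive.

Import Order.TTheory GRing.Theory Num.Theory.
Import numFieldNormedType.Exports.

Local Open Scope classical_set_scope.
Local Open Scope ring_scope.

(* [mpoly] is not imported: its notations clash with those of
   mathcomp-analysis. *)

Section Polytopes.
Variable R : realType.
Implicit Types (A P Q H : set 'rV[R]_3) (v : 'rV[R]_3).

Definition closed_halfspace H : Prop :=
  exists (a : 'rV[R]_3) (b : R),
    a != 0 /\ H = [set x | \sum_(j < 3) a 0 j * x 0 j <= b].

Definition polytope P : Prop :=
  bounded_set P /\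
  exists (n : nat) (H : 'I_n -> set 'rV[R]_3),
    (forall i, closed_halfspace (H i)) /\ P = \bigcap_(i in setT) H i.

Definition affine_hull A : set 'rV[R]_3 :=
  [set x | exists (n : nat) (c : 'I_n -> R) (y : 'I_n -> 'rV[R]_3),
     [/\ forall i, A (y i), \sum_(i < n) c i = 1
       & x = \sum_(i < n) c i *: y i]].

Definition convex_hull A : set 'rV[R]_3 :=
  [set x | exists (n : nat) (c : 'I_n -> R) (y : 'I_n -> 'rV[R]_3),
     [/\ forall i, A (y i), forall i, 0 <= c i, \sum_(i < n) c i = 1
       & x = \sum_(i < n) c i *: y i]].

(* The affine hull of A is a translate p + U of a linear subspace U of
   dimension d, where U is given as the row space of a matrix. The empty set
   has no dimension in this sense. *)
Definition has_dim (d : nat) A : Prop :=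
  exists (p : 'rV[R]_3) (U : 'M[R]_3),
    \rank U = d /\ affine_hull A = [set x | (x - p <= U)%MS].

Definition polytope_of_dim (d : nat) P : Prop := polytope P /\ has_dim d P.

Definition pyramid P : Prop :=
  exists Q v, polytope_of_dim 2 Q /\ P = convex_hull (Q `|` [set v]).

Definition prism P : Prop :=
  exists Q v, polytope_of_dim 2 Q /\
    P = [set q + s | q in Q & s in convex_hull [set 0; v]].

Definition poly_nonneg_set (l : nat) (p : 'I_l -> mpoly.mpoly 3 R) :
    set 'rV[R]_3 :=
  [set x | forall i, 0 <= mpoly.meval (fun j => x 0 j) (p i)].

Definition representable (l : nat) P : Prop :=
  exists p : 'I_l -> mpoly.mpoly 3 R, P = poly_nonneg_set p.

(* The least l such that P is [representable l]; the default value 0 is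
   returned only if there is no such l. *)
Definition m_poly P : nat :=
  xget 0%N [set l | representable l P /\
                    forall k, representable k P -> (l <= k)%N].

End Polytopes.

(* Main.v *)
Require Import Defs.
From mathcomp Require Import all_boot all_order all_algebra.
From mathcomp.multinomials Require mpoly.
From mathcomp Require Import all_classical all_reals.
From mathcomp Require Import topology normedtype sequences.
From mathcomp Require Import ring lra.

Set Implicit Arguments.
Unset Strict Implicit.
Unset Printing Implicit Defensive.

Import Order.TTheory GRing.Theory Num.Theory.
Import numFieldNormedType.Exports.
Import (canonicals) mpoly.

Local Open Scope classical_set_scope.
Local Open Scope ring_scope.

(** Lower bound. Suppose that two polynomials [F] and [G] describe [P], and let
    [Q] be the base of [P]. Every point of [Q] is a limit of points outside [P],
    where one of [F], [G] is negative; so [F * G] vanishes on [Q], and therefore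
    [F] or [G] vanishes on the whole plane of [Q] ([vanishing_product]). The
    other one alone describes [Q] in this plane. It changes sign across each
    edge of [Q], so it vanishes on the line spanned by an edge, and this line
    would lie in the bounded set [Q] ([polygon_not_one_polynomial]).

    Upper bound. It is enough to describe a polygon by two polynomials, in a
    form that can be homogenised ([polygon_two_polynomials]). Let [l i >= 0] be
    an irredundant system of linear inequalities for the polygon. The first
    polynomial is the product of the [l i]; outside the polygon it can be
    nonnegative only at points beyond one edge and on or beyond the line of
    another one. The second polynomial has to exclude these points. For each
    vertex [w] let [u_w] be an affine form with [u_w w = 1] and with values in
    the interval from 0 to 1, 1 excluded, at all other vertices. If [N] is a
    large even number, the matrix of the numbers [u_w v ^ N] is close to the
    identity, so there are positive coefficients [lam_w] for which
    [g = \sum_w lam_w * u_w ^ N] equals 1 at every vertex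
    ([vertex_interpolation]). The set [g <= 1] is convex, hence contains the
    polygon, and it is strictly convex at the vertices, which lie on its
    boundary. So the parts of it beyond two different edges do not meet
    ([caps_disjoint]), and the second polynomial is [1 - g].

    For a prism, the two polynomials of the base are constant along the third
    direction, and the height [h] is restricted by [h * (1 - h) >= 0]. For a
    pyramid with apex at height 0, they are homogenised with [h]; the same third
    polynomial is used. Here one needs that the apex is the only solution at
    height 0, that is, that the linear parts of the [u_w] have no common zero
    ([no_common_line]). *)

(** * Affine forms *)

Definition affform (R : realType) n := (R * 'rV[R]_n)%type.

Definition dot (R : realType) n (a x : 'rV[R]_n) : R :=
  \sum_(j < n) a 0 j * x 0 j.

Definition ev (R : realType) n (l : affform R n) (x : 'rV[R]_n) : R :=
  l.1 + dot l.2 x.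

Definition in_poly (R : realType) n (I : Type) (l : I -> affform R n)
    (x : 'rV[R]_n) : Prop := forall i, 0 <= ev (l i) x.

(** Boundedness, in the form that is invariant under affine charts. *)
Definition no_ray (R : realType) n (I : Type) (l : I -> affform R n) : Prop :=
  forall y d, (forall t, 0 <= t -> in_poly l (y + t *: d)) -> d = 0.

Section AffineForms.
Variables (R : realType) (n : nat).
Implicit Types (a x y d : 'rV[R]_n) (l : affform R n).

Lemma dotDr a x y : dot a (x + y) = dot a x + dot a y.
Proof. by rewrite -big_split; apply: eq_bigr => j _; rewrite mxE mulrDr. Qed.

Lemma dotZr a x t : dot a (t *: x) = t * dot a x.
Proof. by rewrite mulr_sumr; apply: eq_bigr => j _; rewrite mxE mulrCA. Qed.

Lemma dotNr a x : dot a (- x) = - dot a x.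
Proof. by rewrite -scaleN1r dotZr mulN1r. Qed.

Lemma dotDl a b x : dot (a + b) x = dot a x + dot b x.
Proof. by rewrite -big_split; apply: eq_bigr => j _; rewrite mxE mulrDl. Qed.

Lemma dotZl a x t : dot (t *: a) x = t * dot a x.
Proof. by rewrite mulr_sumr; apply: eq_bigr => j _; rewrite mxE mulrA. Qed.

Lemma dot0l x : dot 0 x = 0.
Proof. by rewrite -(scale0r 0) dotZl mul0r. Qed.

Lemma dot0r a : dot a 0 = 0.
Proof. by rewrite -(scale0r 0) dotZr mul0r. Qed.

Lemma dot_sumr a (J : Type) (r : seq J) (P : pred J) (F : J -> 'rV[R]_n) :
  dot a (\sum_(j <- r | P j) F j) = \sum_(j <- r | P j) dot a (F j).
Proof.
apply: (big_morph (dot a)) => [x y|]; [exact: dotDr|exact: dot0r].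
Qed.

Lemma dot_suml x (J : Type) (r : seq J) (P : pred J) (F : J -> 'rV[R]_n) :
  dot (\sum_(j <- r | P j) F j) x = \sum_(j <- r | P j) dot (F j) x.
Proof.
by apply: (big_morph (fun a => dot a x)) => [a b|]; [exact: dotDl|exact: dot0l].
Qed.

Lemma dot_self_gt0 a : a != 0 -> 0 < dot a a.
Proof.
move=> a0; have ge0 j : true -> 0 <= a 0 j * a 0 j by rewrite -expr2 sqr_ge0.
rewrite lt_def sumr_ge0 // andbT; apply: contra a0; rewrite psumr_eq0 //.
move=> /allP h; apply/eqP/rowP => j; rewrite mxE.
by have := h j (mem_index_enum _); rewrite mulf_eq0 orbb => /eqP.
Qed.

Lemma evD l x d : ev l (x + d) = ev l x + dot l.2 d.
Proof. by rewrite /ev dotDr addrA. Qed.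

Lemma evDZ l x t d : ev l (x + t *: d) = ev l x + t * dot l.2 d.
Proof. by rewrite evD dotZr. Qed.

Lemma dotB_ev l x y : dot l.2 (y - x) = ev l y - ev l x.
Proof. by rewrite /ev dotDr dotNr; ring. Qed.

Lemma ev_segment l x y t :
  ev l (x + t *: (y - x)) = (1 - t) * ev l x + t * ev l y.
Proof. by rewrite evDZ dotB_ev; ring. Qed.

End AffineForms.

Lemma affine_ge0_near (R : realType) (I : finType) (a b : I -> R) :
  (forall i, 0 <= a i) -> (forall i, a i = 0 -> 0 <= b i) ->
  exists2 e, 0 < e & forall i t, 0 <= t <= e -> 0 <= a i + t * b i.
Proof.
move=> a0 ab; pose e := \big[Num.min/1]_(i | 0 < a i) (a i / (1 + `|b i|)).
have b1 i : 0 < 1 + `|b i| by have := normr_ge0 (b i); lra.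
exists e.
  apply: (big_ind (fun x => 0 < x)) => // [x y x0 y0|i ai].
    by rewrite lt_min x0.
  exact: divr_gt0.
move=> i t /andP[t0 te]; have := a0 i; rewrite le_eqVlt => /predU1P[ai|ai].
  by rewrite -ai add0r mulr_ge0 // ab.
have : t <= a i / (1 + `|b i|) by apply: le_trans te _; exact: bigmin_le_cond.
rewrite ler_pdivlMr // => h; have := ler_norm (- b i); rewrite normrN => h2.
have : t * - b i <= t * `|b i| by rewrite ler_wpM2l.
by nra.
Qed.

(** The last point of a bounded polyhedron on a ray: the constraint that
    attains the smallest ratio becomes active there. *)
Lemma exit_point (R : realType) n (I : finType) (l : I -> affform R n) y d :
  no_ray l -> in_poly l y -> d != 0 ->
  exists (b : R) k, [/\ 0 <= b, in_poly l (y + b *: d),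
    ev (l k) (y + b *: d) = 0 & dot (l k).2 d < 0].
Proof.
move=> nr Qy d0.
have [k0 hk0] : exists k, dot (l k).2 d < 0.
  apply: contrapT => /forallNP h; move/eqP: d0; apply; apply: nr => t t0 i.
  by rewrite evDZ addr_ge0 ?mulr_ge0 // leNgt; apply/negP/h.
pose F k := ev (l k) y / - dot (l k).2 d.
have [k hk hmin] := @arg_minP _ _ _ k0 (fun k => dot (l k).2 d < 0) F hk0.
have e1 : ev (l k) (y + F k *: d) = 0.
  by rewrite evDZ /F; field; rewrite lt_eqF.
have Fk0 : 0 <= F k by rewrite /F divr_ge0 // oppr_ge0 ltW.
exists (F k), k; split => // i; rewrite evDZ.
have [hi|hi] := ltP (dot (l i).2 d) 0; last first.
  by apply: addr_ge0; [exact: Qy | exact: mulr_ge0].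
have := hmin i hi; rewrite {2}/F ler_pdivlMr ?oppr_gt0 //; lra.
Qed.

(** * Plane polygons *)

Section Plane.
Variable R : realType.

Lemma dot2E (a x : 'rV[R]_2) : dot a x = a 0 0 * x 0 0 + a 0 1 * x 0 1.
Proof.
rewrite /dot big_ord_recl big_ord1.
by have -> : lift ord0 ord0 = 1 :> 'I_2 by exact: val_inj.
Qed.

Lemma row2P (x y : 'rV[R]_2) : x 0 0 = y 0 0 -> x 0 1 = y 0 1 -> x = y.
Proof.
move=> h0 h1; apply/rowP; case=> -[|[|//]] hi.
  by rewrite (_ : Ordinal hi = 0) //; exact: val_inj.
by rewrite (_ : Ordinal hi = 1) //; exact: val_inj.
Qed.

Definition perp (a : 'rV[R]_2) : 'rV[R]_2 :=
  \row_j (if j == 0 then a 0 1 else - a 0 0).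

Lemma dot_perp (a : 'rV[R]_2) : dot a (perp a) = 0.
Proof. by rewrite dot2E !mxE /=; ring. Qed.

Lemma perp_eq0 (a : 'rV[R]_2) : (perp a == 0) = (a == 0).
Proof.
apply/eqP/eqP => [h|->]; last by apply: row2P; rewrite !mxE //= oppr0.
by apply: row2P; have := congr1 (fun x : 'rV_2 => x 0 0) h;
  have := congr1 (fun x : 'rV_2 => x 0 1) h; rewrite !mxE //= => /eqP;
  rewrite oppr_eq0 => /eqP.
Qed.

Lemma orth_parallel (a d e : 'rV[R]_2) :
  a != 0 -> d != 0 -> dot a d = 0 -> dot a e = 0 -> exists t, e = t *: d.
Proof.
move=> a0 d0 ad ae; exists (dot d e / dot d d).
have dd : 0 < dot d d := dot_self_gt0 d0.
have aa : 0 < dot a a := dot_self_gt0 a0.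
have det : d 0 0 * e 0 1 = d 0 1 * e 0 0.
  have h : dot a a * (d 0 0 * e 0 1 - d 0 1 * e 0 0) = 0.
    move: ad ae; rewrite !dot2E => ad ae.
    transitivity
      ((a 0 0 * e 0 1 - a 0 1 * e 0 0) * (a 0 0 * d 0 0 + a 0 1 * d 0 1)
       - (a 0 0 * d 0 1 - a 0 1 * d 0 0) * (a 0 0 * e 0 0 + a 0 1 * e 0 1)).
      by ring.
    by rewrite ad ae; ring.
  by move/eqP: h; rewrite mulf_eq0 (gt_eqF aa) /= subr_eq0 => /eqP.
apply: row2P; rewrite mxE mulrAC; apply: (canRL (mulfK (lt0r_neq0 dd)));
  rewrite !dot2E.
  by have := congr1 ( *%R (d 0 1)) det; lra.
by have := congr1 ( *%R (d 0 0)) det; lra.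
Qed.

End Plane.

(** Irredundancy of the system [l] is given by a point [f i] in the relative
    interior of each edge: there, [l i] is the only active inequality. *)
Section EdgeSystem.
Variables (R : realType) (I : finType).
Variables (l : I -> affform R 2) (f : I -> 'rV[R]_2).
Hypothesis f0 : forall i, ev (l i) (f i) = 0.
Hypothesis fpos : forall i k, k != i -> 0 < ev (l k) (f i).
Hypothesis a0 : forall i, (l i).2 != 0.
Hypothesis nr : no_ray l.

(** Extremality in terms of the active inequalities: their sum vanishes at [w]
    and nowhere else on the polygon. *)
Definition vertex (w : 'rV[R]_2) : Prop := in_poly l w /\
  forall z, in_poly l z ->
    (forall k, ev (l k) w = 0 -> ev (l k) z = 0) -> z = w.

Definition edge_dir i (s : bool) : 'rV[R]_2 := (-1) ^+ s *: perp (l i).2.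

Lemma edge_dir_neq0 i s : edge_dir i s != 0.
Proof. by rewrite scaler_eq0 signr_eq0 perp_eq0 a0. Qed.

Lemma dot_edge_dir i s : dot (l i).2 (edge_dir i s) = 0.
Proof. by rewrite dotZr dot_perp mulr0. Qed.

Lemma in_poly_edge i : in_poly l (f i).
Proof.
move=> k; have [->|ki] := eqVneq k i; first by rewrite f0.
by rewrite ltW // fpos.
Qed.

(** The end of edge [i] is a vertex, because the inequality that becomes active
    there is not constant along the edge. *)
Lemma edge_end i s : exists (b : R) k, [/\ 0 < b,
  vertex (f i + b *: edge_dir i s), k != i,
  ev (l k) (f i + b *: edge_dir i s) = 0 & dot (l k).2 (edge_dir i s) < 0].
Proof.
set d := edge_dir i s; have d0 : d != 0 := edge_dir_neq0 i s.
have ad : dot (l i).2 d = 0 := dot_edge_dir i s.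
have [b [k [b0 Qw kw kd]]] := exit_point nr (in_poly_edge i) d0.
have ki : k != i by apply: contraTneq kd => ->; rewrite ad ltxx.
have bp : 0 < b.
  rewrite lt_def b0 andbT; apply: contra_eq_neq kw => ->.
  by rewrite scale0r addr0 gt_eqF // fpos.
exists b, k; split=> //; split=> // z Qz act.
set w := f i + b *: d in Qw kw act *.
have iw : ev (l i) w = 0 by rewrite /w evDZ f0 ad mulr0 addr0.
have [t ht] : exists t, z - w = t *: d.
  by apply: orth_parallel (a0 i) d0 ad _; rewrite dotB_ev iw act // subr0.
have : dot (l k).2 (z - w) = 0 by rewrite dotB_ev kw act // subr0.
rewrite ht dotZr => /eqP; rewrite mulf_eq0 (lt_eqF kd) orbF => /eqP t0.
by apply/eqP; rewrite -subr_eq0 ht t0 scale0r.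
Qed.

Lemma vertex_list : exists V : seq 'rV[R]_2,
  [/\ uniq V, forall w, w \in V -> vertex w
    & forall i s, exists (b : R) k, [/\ 0 < b, f i + b *: edge_dir i s \in V,
        k != i, ev (l k) (f i + b *: edge_dir i s) = 0
        & dot (l k).2 (edge_dir i s) < 0]].
Proof.
have /choice[e he] : forall p : I * bool, exists w : 'rV[R]_2, exists (b : R) k,
    [/\ 0 < b /\ vertex w, w = f p.1 + b *: edge_dir p.1 p.2, k != p.1,
        ev (l k) w = 0 & dot (l k).2 (edge_dir p.1 p.2) < 0].
  move=> [i s]; have [b [k [b0 vw ki kw kd]]] := edge_end i s.
  by exists (f i + b *: edge_dir i s), b, k.
exists (undup [seq e p | p <- enum {: I * bool}]); split.
- exact: undup_uniq.
- move=> w; rewrite mem_undup => /mapP[p _ ->].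
  by have [b [k [[]]]] := he p.
move=> i s; have [b [k [[b0 _] ew ki kw kd]]] := he (i, s).
exists b, k; rewrite -[_ + _]ew; split=> //.
by rewrite mem_undup map_f // mem_enum.
Qed.

Variable V : seq 'rV[R]_2.
Hypothesis Vvertex : forall w, w \in V -> vertex w.
Hypothesis Vend : forall i s, exists (b : R) k, [/\ 0 < b,
  f i + b *: edge_dir i s \in V, k != i,
  ev (l k) (f i + b *: edge_dir i s) = 0 & dot (l k).2 (edge_dir i s) < 0].

Lemma edge_coord i y : ev (l i) y = 0 -> exists t, y = f i + t *: perp (l i).2.
Proof.
move=> iy; have [t ht] : exists t, y - f i = t *: perp (l i).2.
  apply: orth_parallel (a0 i) _ (dot_perp _) _; first by rewrite perp_eq0.
  by rewrite dotB_ev iy f0 subr0.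
by exists t; rewrite -ht addrC subrK.
Qed.

(** A polygon is contained in the convex hull of its vertices: an edge is the
    segment between its ends, and any other point lies between two points on
    edges. *)
Lemma in_poly_hull (K : 'rV[R]_2 -> Prop) :
  (forall x y t, 0 <= t <= 1 -> K x -> K y -> K (x + t *: (y - x))) ->
  (forall w, w \in V -> K w) -> forall y, in_poly l y -> K y.
Proof.
move=> Kc KV; have Kedge i y : in_poly l y -> ev (l i) y = 0 -> K y.
  move=> Qy /edge_coord[t yt].
  have [b1 [k1 [b10 V1 _ e1 d1]]] := Vend i false.
  have [b2 [k2 [b20 V2 _ e2 d2]]] := Vend i true.
  set p := perp (l i).2 in yt *.
  have pE1 : edge_dir i false = p by rewrite /edge_dir scale1r.
  have pE2 : edge_dir i true = - p by rewrite /edge_dir scaleN1r.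
  rewrite pE1 in V1 e1 d1; rewrite pE2 in V2 e2 d2.
  have t1 : t <= b1.
    have := Qy k1; move: e1; rewrite yt !evDZ => e1 e1'.
    have : 0 <= (t - b1) * dot (l k1).2 p by lra.
    by rewrite nmulr_lge0 // subr_le0.
  have t2 : - b2 <= t.
    have := Qy k2; move: e2 d2; rewrite yt !evDZ dotNr oppr_lt0 => e2 d2 e2'.
    have : 0 <= (t + b2) * dot (l k2).2 p by lra.
    by rewrite pmulr_lge0 // => h; rewrite -subr_ge0 opprK.
  have bb : 0 < b1 + b2 by lra.
  have -> : y = (f i + b2 *: - p) +
      ((t + b2) / (b1 + b2)) *: ((f i + b1 *: p) - (f i + b2 *: - p)).
    by rewrite yt; apply/rowP => j; rewrite !mxE; field; rewrite gt_eqF.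
  apply: Kc; [|exact: KV|exact: KV].
  by rewrite divr_ge0 ?ler_pdivrMr //= ; lra.
move=> y Qy; pose d : 'rV[R]_2 := const_mx 1.
have d0 : d != 0.
  by apply/eqP => /rowP/(_ 0); rewrite !mxE => /eqP; rewrite oner_eq0.
have nd0 : - d != 0 by rewrite oppr_eq0.
have [b1 [k1 [b10 Q1 e1 _]]] := exit_point nr Qy d0.
have [b2 [k2 [b20 Q2 e2 _]]] := exit_point nr Qy nd0.
have := Kedge _ _ Q1 e1; have := Kedge _ _ Q2 e2.
have [->|b1p] := eqVneq b1 0; first by rewrite scale0r addr0.
have bb : 0 < b1 + b2 by rewrite ltr_pwDl // lt_def b1p.
move=> K2 K1.
have -> : y = (y + b2 *: - d) + (b2 / (b1 + b2)) *:
    ((y + b1 *: d) - (y + b2 *: - d)).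
  by apply/rowP => j; rewrite !mxE; field; rewrite gt_eqF.
apply: Kc => //; rewrite divr_ge0 ?ler_pdivrMr //=; lra.
Qed.

Section Caps.
Variable K : 'rV[R]_2 -> Prop.
(* Strict convexity of [K] at the vertices, which are boundary points of it. *)
Hypothesis Kstrict : forall w x z t, w \in V -> K x -> in_poly l z -> z != w ->
  0 < t < 1 -> w = x + t *: (z - x) -> False.

(** The caps that the edges cut off from [K] are disjoint. If [x] lies beyond
    edge [i], a vertex at an end of edge [i] is not strictly between [x] and a
    point of the polygon, so some edge through this vertex has [x] strictly on
    its inner side. Hence the segment from [x] to the point [f j] of another
    edge enters the polygon through the relative interior of edge [i]. The form
    [l j] is positive there and vanishes at [f j], so it is positive at [x]. *)
Lemma caps_disjoint i j x : i != j -> K x ->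
  ev (l i) x < 0 -> ev (l j) x <= 0 -> False.
Proof.
move=> ij Kx ix jx.
have side s : exists (b : R) k, [/\ 0 < b, in_poly l (f i + b *: edge_dir i s),
    ev (l k) (f i + b *: edge_dir i s) = 0, 0 < ev (l k) x
    & dot (l k).2 (edge_dir i s) < 0].
  have [b [_ [b0 wV _ _ _]]] := Vend i s.
  set w := f i + _ in wV; have [Qw _] := Vvertex wV.
  have [[k [kw kx]]|/forallNP nk] :=
      pselect (exists k, ev (l k) w = 0 /\ 0 < ev (l k) x).
    exists b, k; split=> //.
    have ki : k != i by apply: contraTneq kx => ->; rewrite -leNgt ltW.
    by have := fpos ki; move: kw; rewrite /w evDZ; nra.
  exfalso; have [|e e0 he] := @affine_ge0_near _ _
      (fun k => ev (l k) w) (fun k => dot (l k).2 (w - x)) Qw.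
    move=> k kw; rewrite dotB_ev kw sub0r oppr_ge0 leNgt; apply/negP => kx.
    exact: (nk k).
  have e1 : 0 < 1 + e by lra.
  have wx : w - x != 0.
    rewrite subr_eq0; apply: contraTneq ix => <-; rewrite -leNgt; exact: Qw.
  apply: (@Kstrict w x (w + e *: (w - x)) (1 + e)^-1) => //.
  - by move=> k; rewrite evDZ he // ltW ?lexx.
  - by rewrite -subr_eq0 addrAC subrr add0r scaler_eq0 negb_or gt_eqF.
  - by rewrite invr_gt0 e1 invf_lt1 // ltrDl.
  - by apply/rowP => m; rewrite !mxE; field; rewrite gt_eqF.
have [b1 [k1 [b10 Q1 w1 x1 d1]]] := side false.
have [b2 [k2 [b20 Q2 w2 x2 d2]]] := side true.
set p := perp (l i).2.
have pE1 : edge_dir i false = p by rewrite /edge_dir scale1r.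
have pE2 : edge_dir i true = - p by rewrite /edge_dir scaleN1r.
rewrite pE1 in Q1 w1 d1; rewrite pE2 in Q2 w2 d2.
have jfi := fpos ij; have Qj := in_poly_edge j.
pose s := - ev (l i) x / (ev (l i) (f j) - ev (l i) x).
have den : 0 < ev (l i) (f j) - ev (l i) x by lra.
have s0 : 0 < s by rewrite divr_gt0 // oppr_gt0.
have s1 : s < 1 by rewrite ltr_pdivrMr // mul1r; lra.
pose y := x + s *: (f j - x).
have iy : ev (l i) y = 0 by rewrite ev_segment /s; field; rewrite gt_eqF.
have pos k : 0 < ev (l k) x -> 0 < ev (l k) y.
  by move=> kx; rewrite ev_segment; have := Qj k; nra.
have jy : ev (l j) y <= 0 by rewrite ev_segment f0; nra.
have [t yt] := edge_coord iy.
have y1 := pos _ x1; have y2 := pos _ x2.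
rewrite yt !evDZ -/p in y1 y2 jy.
rewrite !evDZ in w1 w2.
have t1 : t < b1.
  have : 0 < (t - b1) * dot (l k1).2 p by lra.
    by rewrite nmulr_lgt0 // subr_lt0.
have t2 : - b2 < t.
  move: d2 w2; rewrite dotNr oppr_lt0 => d2 w2.
  have : 0 < (t + b2) * dot (l k2).2 p by lra.
    by rewrite pmulr_lgt0 // => h; rewrite -subr_gt0 opprK.
have := Q1 j; have := Q2 j; rewrite !evDZ dotNr => q2 q1.
have := fpos (_ : j != i); rewrite eq_sym => /(_ ij) jf.
by have [D|D|D] := ltgtP (dot (l j).2 p) 0; nra.
Qed.

(** If [K] contained a line with direction [d] through every vertex, the forms
    of the two edges at a vertex would have slopes of opposite signs along [d],
    since their caps are disjoint. Applied to both ends of edge [i], this makes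
    the forms of the two neighbours of [i] decrease in the same direction, and a
    distant point of the line lies in the caps of both. *)
Lemma no_common_line d :
  (forall w t, w \in V -> K (w + t *: d)) -> d = 0.
Proof.
move=> Kd; apply/eqP/negPn/negP => d0.
have [i] : inhabited I.
  apply: contrapT => nI; move/eqP: d0; apply; apply: (nr (y := 0)) => t _ i.
  by case: nI.
have opp w k m : w \in V -> ev (l k) w = 0 -> ev (l m) w = 0 -> k != m ->
    dot (l k).2 d < 0 -> 0 < dot (l m).2 d.
  move=> wV kw mw km kd; rewrite ltNge; apply/negP => md.
  by apply: (caps_disjoint km (Kd w 1 wV)); rewrite evDZ mul1r ?kw ?mw add0r.
have opp' w k m : w \in V -> ev (l k) w = 0 -> ev (l m) w = 0 -> k != m ->
    0 < dot (l k).2 d -> dot (l m).2 d < 0.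
  move=> wV kw mw km kd; rewrite ltNge; apply/negP => md.
  by apply: (caps_disjoint km (Kd w (-1) wV)); rewrite evDZ ?kw ?mw; lra.
have [b1 [k1 [b10 V1 n1 w1 d1]]] := Vend i false.
have [b2 [k2 [b20 V2 n2 w2 d2]]] := Vend i true.
rewrite eq_sym in n1; rewrite eq_sym in n2.
have i1 : ev (l i) (f i + b1 *: edge_dir i false) = 0.
  by rewrite evDZ f0 dot_edge_dir mulr0 addr0.
have i2 : ev (l i) (f i + b2 *: edge_dir i true) = 0.
  by rewrite evDZ f0 dot_edge_dir mulr0 addr0.
have k12 : k1 != k2.
  apply: contraTneq d2 => <-; move: d1.
  by rewrite /edge_dir scale1r scaleN1r dotNr -leNgt oppr_ge0; exact: ltW.
have far t : dot (l k1).2 d * t < 0 -> dot (l k2).2 d * t < 0 -> False.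
  move=> h1 h2; set w := f i + _ in V1 w1.
  pose r := (1 + ev (l k2) w) / - (dot (l k2).2 d * t).
  have Qw := (Vvertex V1).1 k2.
  have r0 : 0 < r by rewrite divr_gt0 ?oppr_gt0 //; lra.
  have k20 : dot (l k2).2 d != 0.
    by apply: contraTneq h2 => ->; rewrite mul0r ltxx.
  have t0 : t != 0 by apply: contraTneq h2 => ->; rewrite mulr0 ltxx.
  apply: (caps_disjoint k12 (Kd w (r * t) V1)); rewrite evDZ.
    by rewrite w1 add0r -mulrA pmulr_rlt0 // mulrC.
  rewrite (_ : _ + _ = -1) ?lerN10 // /r; field.
  by rewrite t0 k20.
have [D|D|D] := ltgtP (dot (l i).2 d) 0.
- have := opp _ _ _ V1 i1 w1 n1 D; have := opp _ _ _ V2 i2 w2 n2 D.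
  by move=> h2 h1; apply: (far (-1)); lra.
- have := opp' _ _ _ V1 i1 w1 n1 D; have := opp' _ _ _ V2 i2 w2 n2 D.
  by move=> h2 h1; apply: (far 1); lra.
have [t dt] : exists t, d = t *: edge_dir i false.
  exact: orth_parallel (a0 i) (edge_dir_neq0 _ _) (dot_edge_dir _ _) D.
have [E|E|E] := ltgtP (dot (l k1).2 d) 0.
- have := opp _ _ _ V1 w1 i1 (_ : k1 != i) E.
  by rewrite D eq_sym ltxx => /(_ n1).
- have := opp' _ _ _ V1 w1 i1 (_ : k1 != i) E.
  by rewrite D eq_sym ltxx => /(_ n1).
move: E d0; rewrite dt dotZr => /eqP.
rewrite mulf_eq0 (lt_eqF d1) orbF => /eqP->.
by rewrite scale0r eqxx.
Qed.

End Caps.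

End EdgeSystem.

(** * Interpolation at the vertices by even powers of affine forms *)

Section EvenPowers.
Variable R : realType.
Implicit Types (x y t : R).

Lemma exp_pow2_ge0 m x : 0 <= x ^+ (2 ^ m.+1).
Proof. by apply: exprn_even_ge0; rewrite oddX. Qed.

(** The exponent is a power of two so that convexity follows by repeated
    squaring. *)
Lemma exp_pow2_strict_convex m t x y : 0 < t < 1 -> x != y ->
  (x + t * (y - x)) ^+ (2 ^ m.+1) <
    (1 - t) * x ^+ (2 ^ m.+1) + t * y ^+ (2 ^ m.+1).
Proof.
move=> /andP[t0 t1] xy; elim: m => [|m IHm].
  rewrite expn1 -subr_gt0.
  rewrite (_ : _ - _ = t * (1 - t) * (x - y) ^+ 2); last by ring.
  by rewrite mulr_gt0 ?exprn_even_gt0 ?subr_eq0 // mulr_gt0 // subr_gt0.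
have := exp_pow2_ge0 m (x + t * (y - x)).
have := exp_pow2_ge0 m x; have := exp_pow2_ge0 m y.
rewrite (expnSr 2 m.+1) !(exprM _ (2 ^ m.+1) 2); move: IHm.
set a := x ^+ _; set b := y ^+ _; set c := (_ + _) ^+ _ => cab b0 a0 c0.
apply: (@lt_le_trans _ _ (((1 - t) * a + t * b) ^+ 2)).
  by rewrite ltr_pXn2r ?nnegrE //; apply: le_trans c0 (ltW cab).
rewrite -subr_ge0 (_ : _ - _ = t * (1 - t) * (a - b) ^+ 2); last by ring.
by rewrite mulr_ge0 ?sqr_ge0 // mulr_ge0 ?subr_ge0 // ltW.
Qed.

Lemma exp_pow2_convex m t x y : 0 <= t <= 1 ->
  (x + t * (y - x)) ^+ (2 ^ m.+1) <=
    (1 - t) * x ^+ (2 ^ m.+1) + t * y ^+ (2 ^ m.+1).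
Proof.
move=> /andP[t0 t1]; have [->|xy] := eqVneq x y.
  by rewrite subrr mulr0 addr0 -mulrDl subrK mul1r.
have [->|tn0] := eqVneq t 0; first by rewrite !mul0r subr0 mul1r !addr0.
have [->|tn1] := eqVneq t 1.
  by rewrite !mul1r subrr mul0r add0r addrC subrK.
apply/ltW/exp_pow2_strict_convex => //.
by rewrite !lt_def tn0 t0 t1 eq_sym tn1.
Qed.

Lemma exp_pow2_small (J : finType) (v : J -> R) e : 0 < e ->
  (forall j, 0 <= v j < 1) -> exists m, forall j, v j ^+ (2 ^ m.+1) <= e.
Proof.
move=> e0 v01.
have : \forall k \near \oo, forall j, v j ^+ k <= e.
  apply: filter_forall => j; have /andP[v0 v1] := v01 j.
  have vj : `|v j| < 1 by rewrite ger0_norm.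
  have /cvgr0Pnorm_lt/(_ e e0) := cvg_expr vj.
  by apply: filterS => k /ltW; rewrite ger0_norm // exprn_ge0.
case=> m _ hm; exists m => j; apply: hm => /=.
by apply: ltnW; apply: ltn_trans (ltnSn m) (ltn_expl _ _).
Qed.

(** Multiplication by [M] moves a row vector by at most a quarter of its
    sup-norm. So [M] is invertible, and the solution differs from the all-ones
    vector by less than 1 in each entry. *)
Lemma near_id_solution n (M : 'M[R]_n) e :
  0 <= e -> n%:R * e <= 1 / 4 -> (forall j, M j j = 1) ->
  (forall i j, i != j -> 0 <= M i j <= e) ->
  exists lam : 'I_n -> R, (forall i, 0 < lam i) /\
    forall j, \sum_i lam i * M i j = 1.
Proof.
move=> e0 ne Md Mo.
pose B (mu : 'rV[R]_n) := \big[Num.max/0]_i `|mu 0 i|.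
have muB (mu : 'rV_n) i : `|mu 0 i| <= B mu by exact: le_bigmax.
have B0 mu : 0 <= B mu by exact: bigmax_ge_id.
have close (mu : 'rV_n) j : `|(mu *m M) 0 j - mu 0 j| <= B mu / 4.
  rewrite mxE (bigD1 j) //= Md mulr1 addrAC subrr add0r.
  apply: (le_trans (ler_norm_sum _ _ _)).
  apply: (@le_trans _ _ (\sum_(i < n) B mu * e)).
    rewrite [leRHS](bigD1 j) //=.
    apply: ler_wpDl; first by rewrite mulr_ge0.
    apply: ler_sum => i ij; have /andP[M0 Me] := Mo i j ij.
    by rewrite normrM (ger0_norm M0) ler_pM.
  rewrite sumr_const card_ord -[_ *+ n]mulr_natl mulrCA.
  by rewrite ler_wpM2l // -[leRHS]mul1r.
have Mu : M \in unitmx.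
  rewrite -row_free_unit; apply: inj_row_free => mu muM.
  have b : B mu <= B mu / 4.
    apply: bigmax_le => [|i _]; first by rewrite divr_ge0.
    by have := close mu i; rewrite muM mxE sub0r normrN.
  have Bz : B mu = 0 by have := B0 mu; lra.
  apply/rowP => i; rewrite mxE; apply/eqP; rewrite -normr_le0 -Bz; exact: muB.
pose lam : 'rV_n := const_mx 1 *m invmx M.
have lamM : lam *m M = const_mx 1 by rewrite mulmxKV.
have cl j : `|1 - lam 0 j| <= B lam / 4.
  by have := close lam j; rewrite lamM mxE.
have b : B lam <= 1 + B lam / 4.
  apply: bigmax_le => [|i _]; first by have := B0 lam; lra.
  have := cl i; rewrite distrC => h.
  have := ler_normD (lam 0 i - 1) 1; rewrite subrK normr1; lra.
exists (fun i => lam 0 i); split=> [i|j].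
  by have := ler_norm (1 - lam 0 i); have := cl i; lra.
by have := congr1 (fun v : 'rV_n => v 0 j) lamM; rewrite !mxE.
Qed.

End EvenPowers.

(** * A polygon as the solution set of two polynomial inequalities *)

Section PolygonDescription.
Variables (R : realType) (I : finType).
Variables (l : I -> affform R 2) (f : I -> 'rV[R]_2).
Hypothesis f0 : forall i, ev (l i) (f i) = 0.
Hypothesis fpos : forall i k, k != i -> 0 < ev (l k) (f i).
Hypothesis a0 : forall i, (l i).2 != 0.
Hypothesis nr : no_ray l.

Variable V : seq 'rV[R]_2.
Hypothesis Vvertex : forall w, w \in V -> vertex l w.

(** This factor is small enough for the forms [vertex_form w] to be
    nonnegative at all vertices. *)
Definition vertex_scale : R := (1 + \sum_(v <- V) \sum_k ev (l k) v)^-1.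

Definition vertex_form (w : 'rV[R]_2) : affform R 2 :=
  (1 - vertex_scale * \sum_(k | ev (l k) w == 0) (l k).1,
   - vertex_scale *: \sum_(k | ev (l k) w == 0) (l k).2).

Lemma ev_vertex_form w x : ev (vertex_form w) x =
  1 - vertex_scale * \sum_(k | ev (l k) w == 0) ev (l k) x.
Proof.
rewrite {1}/ev /= dotZl dot_suml mulNr -addrA -opprD -mulrDr.
by rewrite -big_split.
Qed.

Lemma vertex_sum_ge0 (v : 'rV[R]_2) (P : pred I) :
  in_poly l v -> 0 <= \sum_(k | P k) ev (l k) v.
Proof. by move=> Qv; apply: sumr_ge0 => k _; exact: Qv. Qed.

Lemma vertex_total_ge0 : 0 <= \sum_(v <- V) \sum_k ev (l k) v.
Proof.
rewrite big_seq; apply: sumr_ge0 => v vV; apply: vertex_sum_ge0.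
by have [] := Vvertex vV.
Qed.

Lemma vertex_scale_gt0 : 0 < vertex_scale.
Proof. by rewrite invr_gt0; have := vertex_total_ge0; lra. Qed.

Lemma vertex_form_self w : ev (vertex_form w) w = 1.
Proof. by rewrite ev_vertex_form big1 ?mulr0 ?subr0 // => k /eqP. Qed.

Lemma vertex_form_lt1 w z : w \in V -> in_poly l z -> z != w ->
  ev (vertex_form w) z < 1.
Proof.
move=> wV Qz zw; rewrite ev_vertex_form ltrBlDr ltrDl.
rewrite mulr_gt0 ?vertex_scale_gt0 // lt_def vertex_sum_ge0 // andbT.
apply: contra zw; rewrite psumr_eq0 => [|k _]; last exact: Qz.
move=> /allP h; apply/eqP; have [_ uw] := Vvertex wV; apply: uw => // k kw.
by have := h k (mem_index_enum _); rewrite kw eqxx => /eqP.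
Qed.

Lemma vertex_form_ge0 w z : z \in V -> 0 <= ev (vertex_form w) z.
Proof.
move=> zV; rewrite ev_vertex_form subr_ge0 mulrC /vertex_scale.
rewrite ler_pdivrMr ?mul1r.
  2: by have := vertex_total_ge0; lra.
have Qz : in_poly l z by have [] := Vvertex zV.
rewrite (big_rem z) //=.
have h1 : \sum_(k | ev (l k) w == 0) ev (l k) z <= \sum_k ev (l k) z.
  rewrite [leRHS](bigID (fun k => ev (l k) w == 0)) /= lerDl.
  exact: vertex_sum_ge0.
have h2 : 0 <= \sum_(v <- rem z V) \sum_k ev (l k) v.
  rewrite big_seq; apply: sumr_ge0 => v /mem_rem vV; apply: vertex_sum_ge0.
  by have [] := Vvertex vV.
lra.
Qed.

(** At the vertices, the vertex forms take the value 1 on the diagonal and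
    values below 1 off it, so high powers of them are close to the identity
    matrix. *)
Lemma vertex_interpolation : uniq V -> exists m (lam : 'I_(size V) -> R),
  (forall j, 0 < lam j) /\ forall w, w \in V ->
    \sum_j lam j * ev (vertex_form V`_j) w ^+ (2 ^ m.+1) = 1.
Proof.
move=> uV; pose n := size V.
pose e : R := (4 * n.+1%:R)^-1.
have e0 : 0 < e by rewrite invr_gt0 mulr_gt0.
have ne : n%:R * e <= 1 / 4.
  rewrite /e invfM mulrCA div1r ler_piMr ?invr_ge0 //.
  by rewrite ler_pdivrMr // mul1r ler_nat.
pose u (p : 'I_n * 'I_n) := ev (vertex_form V`_p.1) V`_p.2.
have VV (j : 'I_n) : V`_j \in V by rewrite mem_nth.
have [m hm] : exists m, forall p,
    (if p.1 == p.2 then 0 else u p) ^+ (2 ^ m.+1) <= e.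
  apply: exp_pow2_small => // -[i j]; case: eqVneq => //= [_|ij].
    by rewrite lexx ltr01.
  rewrite /u vertex_form_ge0 //= vertex_form_lt1 //.
    by have [] := Vvertex (VV j).
  by rewrite nth_uniq // eq_sym.
pose M : 'M[R]_n := \matrix_(i, j) u (i, j) ^+ (2 ^ m.+1).
have [||lam [lam0 hl]] := @near_id_solution _ _ M e (ltW e0) ne.
- by move=> j; rewrite mxE /u /= vertex_form_self expr1n.
- move=> i j ij; rewrite mxE exp_pow2_ge0 /=.
  by have := hm (i, j); rewrite /= (negPf ij).
exists m, lam; split=> // w wV; have jn : (index w V < n)%N by rewrite index_mem.
rewrite -[RHS](hl (Ordinal jn)); apply: eq_bigr => i _.
by rewrite mxE /u /= nth_index.
Qed.

Hypothesis Vend : forall i s, exists (b : R) k, [/\ 0 < b,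
  f i + b *: edge_dir l i s \in V, k != i,
  ev (l k) (f i + b *: edge_dir l i s) = 0 & dot (l k).2 (edge_dir l i s) < 0].

Variables (m : nat) (lam : 'I_(size V) -> R).
Hypothesis lam0 : forall j, 0 < lam j.

Definition power_sum x :=
  \sum_j lam j * ev (vertex_form V`_j) x ^+ (2 ^ m.+1).
Hypothesis lamV : forall w, w \in V -> power_sum w = 1.

Lemma power_sum_convex x y t : 0 <= t <= 1 ->
  power_sum (x + t *: (y - x)) <= (1 - t) * power_sum x + t * power_sum y.
Proof.
move=> t01; rewrite /power_sum !mulr_sumr -big_split /=; apply: ler_sum => j _.
rewrite evDZ dotB_ev [_ * (lam j * _)]mulrCA [t * (lam j * _)]mulrCA -mulrDr.
by rewrite ler_pM2l // exp_pow2_convex.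
Qed.

Lemma power_sum_le1 y : in_poly l y -> power_sum y <= 1.
Proof.
apply: (in_poly_hull f0 a0 nr Vend (K := fun y => power_sum y <= 1)).
  move=> x z t t01 hx hz; apply: (le_trans (power_sum_convex _ _ t01)).
  by case/andP: t01; nra.
by move=> w /lamV->.
Qed.

Lemma power_sum_strict w x z t : w \in V -> power_sum x <= 1 -> in_poly l z ->
  z != w -> 0 < t < 1 -> w = x + t *: (z - x) -> False.
Proof.
move=> wV hx Qz zw t01 ew.
have hz := power_sum_le1 Qz.
suff : power_sum w < (1 - t) * power_sum x + t * power_sum z.
  by rewrite lamV //; case/andP: t01; nra.
have jn : (index w V < size V)%N by rewrite index_mem.
have ez : ev (vertex_form w) x != ev (vertex_form w) z.
  have h1 : ev (vertex_form w) (x + t *: (z - x)) = 1.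
    by rewrite -ew vertex_form_self.
  have z1 := vertex_form_lt1 wV Qz zw.
  apply/eqP => xz; move: h1 z1; rewrite evDZ dotB_ev xz subrr mulr0 addr0 => ->.
  by rewrite ltxx.
have t01' : 0 <= t <= 1 by case/andP: t01 => *; rewrite !ltW.
rewrite {1}ew /power_sum !mulr_sumr -big_split /=.
rewrite (bigD1 (Ordinal jn)) //= [ltRHS](bigD1 (Ordinal jn)) //=.
apply: ltr_leD; last apply: ler_sum => j _; rewrite evDZ dotB_ev
  [_ * (lam _ * _)]mulrCA [t * (lam _ * _)]mulrCA -mulrDr ?ler_pM2l ?ltr_pM2l //.
  by rewrite nth_index //; exact: exp_pow2_strict_convex.
exact: exp_pow2_convex.
Qed.

(** If the product is nonnegative outside the polygon, one form is negative and
    a second one is nonpositive; disjointness of the caps excludes this. *)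
Lemma polygon_iff y : in_poly l y <->
  0 <= \prod_i ev (l i) y /\ power_sum y <= 1.
Proof.
split=> [Qy|[prod0 hy]].
  by split; [apply: prodr_ge0 => i _; exact: Qy | exact: power_sum_le1].
move=> i; rewrite leNgt; apply/negP => iy.
have [[j [ji jy]]|/forallNP nj] :=
    pselect (exists j, j != i /\ ev (l j) y <= 0).
  rewrite eq_sym in ji.
  exact: (caps_disjoint f0 fpos a0 Vvertex Vend
    (K := fun x => power_sum x <= 1) power_sum_strict ji hy iy jy).
move: prod0; rewrite (bigD1 i) //= nmulr_rge0 // leNgt => /negP; apply.
apply: prodr_gt0 => j ji; rewrite ltNge; apply/negP => jy; exact: (nj j).
Qed.

(** Along a direction that annihilates all vertex forms [power_sum] is constant,
    so the lines through the vertices stay in the region [power_sum <= 1]. *)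
Lemma vertex_forms_definite d :
  (forall j : 'I_(size V), dot (vertex_form V`_j).2 d = 0) -> d = 0.
Proof.
move=> hd; apply: (no_common_line f0 fpos a0 nr Vvertex Vend
  (K := fun x => power_sum x <= 1) power_sum_strict).
move=> w t wV; rewrite -(lamV wV) le_eqVlt; apply/orP; left; apply/eqP.
by apply: eq_bigr => j _; rewrite evDZ hd mulr0 addr0.
Qed.

End PolygonDescription.

(** The last clause makes the homogenised second polynomial negative at
    infinity. *)
Theorem polygon_two_polynomials (R : realType) (I : finType)
    (l : I -> affform R 2) (f : I -> 'rV[R]_2) :
  (forall i, ev (l i) (f i) = 0) ->
  (forall i k, k != i -> 0 < ev (l k) (f i)) ->
  (forall i, (l i).2 != 0) -> no_ray l ->
  exists n m (u : 'I_n -> affform R 2) (lam : 'I_n -> R),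
  [/\ forall j, 0 < lam j,
      forall y, in_poly l y <-> 0 <= \prod_i ev (l i) y /\
        \sum_j lam j * ev (u j) y ^+ (2 ^ m.+1) <= 1
    & forall d, (forall j, dot (u j).2 d = 0) -> d = 0].
Proof.
move=> f0 fpos a0 nr; have [V [uV vV eV]] := vertex_list f0 fpos a0 nr.
have [m [lam [lam0 lam1]]] := vertex_interpolation vV uV.
exists (size V), m, (fun j => vertex_form l V V`_j), lam; split=> //.
  exact: polygon_iff.
exact: (vertex_forms_definite f0 fpos a0 nr vV eV lam0 lam1).
Qed.

(** * Irredundant systems *)

Section Irredundant.
Variables (R : realType) (I : finType) (l : I -> affform R 2).

(** An inequality that is not identically an equality on the polygon is strict
    at some point of it; midpoints collect these points into one. *)
Lemma positive_point y0 : in_poly l y0 ->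
  (forall h : affform R 2, (forall y, in_poly l y -> ev h y = 0) -> h = 0) ->
  exists o, in_poly l o /\ forall i, l i = 0 \/ 0 < ev (l i) o.
Proof.
move=> Q0 full.
suff [o [Qo ho]] : exists o, in_poly l o /\
    forall i, i \in enum I -> l i = 0 \/ 0 < ev (l i) o.
  by exists o; split=> // i; apply: ho; rewrite mem_enum.
elim: (enum I) => [|i s [o [Qo ho]]]; first by exists y0.
have [li|nz] := pselect (l i = 0).
  by exists o; split=> // k; rewrite in_cons => /predU1P[->|/ho//]; left.
have [y [Qy iy]] : exists y, in_poly l y /\ ev (l i) y <> 0.
  apply: contrapT => /forallNP h; apply/nz/full => y Qy.
  by apply: contrapT => iy; apply: (h y).
have iy0 : 0 < ev (l i) y by rewrite lt_def Qy andbT; apply/eqP.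
exists (o + 2^-1 *: (y - o)); split.
  by move=> k; rewrite ev_segment; have := Qo k; have := Qy k; lra.
move=> k; rewrite in_cons ev_segment => /predU1P[->|/ho[]]; [right|by left|right].
  by have := Qo i; lra.
by have := Qy k; lra.
Qed.

(** Take a minimal subsystem. Each of its inequalities is violated at a point
    that satisfies the others, and the segment from this point to [o] meets the
    boundary in the relative interior of an edge. *)
Lemma irredundant_subsystem o : in_poly l o ->
  (forall i, l i = 0 \/ 0 < ev (l i) o) ->
  exists (J : finType) (l' : J -> affform R 2) (f : J -> 'rV[R]_2),
  [/\ forall y, in_poly l' y <-> in_poly l y,
      forall j, 0 < ev (l' j) o,
      forall j, ev (l' j) (f j) = 0,
      forall j k, k != j -> 0 < ev (l' k) (f j)
    & forall j, (l' j).2 != 0].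
Proof.
move=> Qo pos.
pose P (S : {set I}) :=
  `[< forall y, (forall i, i \in S -> 0 <= ev (l i) y) -> in_poly l y >].
have [|S /minsetP[/asboolP PS minS]] := @ex_minset _ P.
  exists (finset.setTfor I); apply/asboolP => y h i.
  by apply: h; rewrite finset.in_setT.
have viol i : i \in S -> exists y, ev (l i) y < 0 /\
    forall k, k \in S -> k != i -> 0 <= ev (l k) y.
  move=> iS; apply: contrapT => /forallNP h.
  have : S :\ i = S.
    apply: minS; last exact: finset.subsetDl.
    apply/asboolP => y hy; apply: PS => k kS.
    have [->|ki] := eqVneq k i; last by apply: hy; rewrite finset.in_setD1 ki.
    rewrite leNgt; apply/negP => iy; apply: (h y); split=> // m mS mi.
    by apply: hy; rewrite finset.in_setD1 mi.
  by move/finset.setP/(_ i); rewrite finset.in_setD1 eqxx iS.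
have o0 i : i \in S -> 0 < ev (l i) o.
  move=> iS; have [li|//] := pos i; have [y [+ _]] := viol i iS.
  by rewrite li /ev /= dot0l addr0 ltxx.
have edge (j : {i | i \in S}) : exists x, ev (l (val j)) x = 0 /\
    forall k, k \in S -> k != val j -> 0 < ev (l k) x.
  have jS : val j \in S := valP j; have [y [jy ky]] := viol _ jS.
  have jo := o0 _ jS.
  pose t := ev (l (val j)) o / (ev (l (val j)) o - ev (l (val j)) y).
  have den : 0 < ev (l (val j)) o - ev (l (val j)) y by lra.
  have t1 : t < 1 by rewrite ltr_pdivrMr // mul1r; lra.
  have t0 : 0 < t by rewrite divr_gt0.
  exists (o + t *: (y - o)); split=> [|k kS kj].
    by rewrite ev_segment /t; field; rewrite gt_eqF.
  by rewrite ev_segment; have := ky k kS kj; have := o0 k kS; nra.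
have [f hf] := choice edge.
exists {i | i \in S}, (fun j => l (val j)), f; split.
- move=> y; split=> [h|h j]; last exact: h.
  by apply: PS => i iS; exact: (h (exist _ i iS)).
- by move=> j; apply: o0; exact: valP.
- by move=> j; have [] := hf j.
- by move=> j k kj; have [_] := hf j; apply; [exact: valP|].
move=> j; apply/eqP => a0; have [y [+ _]] := viol _ (valP j).
have := o0 _ (valP j); rewrite /ev a0 !dot0l !addr0 => h1 /(lt_trans h1).
by rewrite ltxx.
Qed.

End Irredundant.

(** * Two polynomials do not suffice *)

(** Only the restrictions of a polynomial to lines enter the arguments. *)
Definition poly_on_lines (R : realType) n (F : 'rV[R]_n -> R) : Prop :=
  forall x d, exists p : {poly R}, forall t, F (x + t *: d) = p.[t].

Section LowerBound.
Variable R : realType.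

Lemma poly_eq0_interval (p : {poly R}) e :
  0 < e -> (forall t, 0 <= t <= e -> p.[t] = 0) -> p = 0.
Proof.
move=> e0 hp; apply: contrapT => /eqP p0.
have := @max_poly_roots _ p [seq e / i.+1%:R | i <- iota 0 (size p)] p0.
rewrite size_map size_iota ltnn => h; suff : false by [].
apply: h.
  apply/allP => _ /mapP[i _ ->]; apply/rootP/hp.
  by rewrite divr_ge0 ?(ltW e0) //= ler_pdivrMr // ler_peMr ?(ltW e0) // ler1n.
rewrite map_inj_uniq ?iota_uniq // => i j.
move=> /(mulfI (lt0r_neq0 e0))/invr_inj/eqP.
by rewrite eqr_nat => /eqP[].
Qed.

Lemma poly_gt0_near (p : {poly R}) : 0 < p.[0] ->
  exists2 e, 0 < e & forall t, 0 <= t <= e -> 0 < p.[t].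
Proof.
move=> p0; have /factor_theorem[q pq] : root (p - p.[0]%:P) 0.
  by rewrite /root !hornerE subrr.
have [b hb] := poly_itv_bound q 0 1.
have b0 : 0 <= b by apply: le_trans (hb 0 _); rewrite ?normr_ge0 ?lexx ?ler01.
pose e := Num.min 1 (p.[0] / (2 * (b + 1))).
have bp : 0 < 2 * (b + 1) by lra.
exists e; first by rewrite lt_min ltr01 divr_gt0.
move=> t /andP[t0]; rewrite le_min ler_pdivlMr // => /andP[t1 te].
have pt : p.[t] = p.[0] + q.[t] * t.
  by rewrite -[in LHS](subrK p.[0]%:P p) pq !hornerE subr0 addrC.
have := hb t; rewrite t0 t1 => /(_ isT); rewrite ler_norml => /andP[qb _].
by rewrite pt; nra.
Qed.

Section Lines.
Variable n : nat.
Implicit Types (F G : 'rV[R]_n -> R).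

Lemma gt0_near F x d : poly_on_lines F -> 0 < F x ->
  exists2 e, 0 < e & forall t, 0 <= t <= e -> 0 < F (x + t *: d).
Proof.
move=> /(_ x d)[p hp] Fx; have [|e e0 he] := @poly_gt0_near p.
  by rewrite -hp scale0r addr0.
by exists e => // t /he; rewrite hp.
Qed.

(** Along each line through [o] the product is a polynomial with infinitely
    many zeros, hence it vanishes identically; then one of the factors vanishes
    on the line through any two points. *)
Lemma vanishing_product F G o : poly_on_lines F -> poly_on_lines G ->
  (forall d, exists2 e, 0 < e &
    forall t, 0 <= t <= e -> F (o + t *: d) * G (o + t *: d) = 0) ->
  (forall x, F x = 0) \/ (forall x, G x = 0).
Proof.
move=> pF pG h.
have FG x : F x * G x = 0.
  have [e e0 he] := h (x - o).
  have [p hp] := pF o (x - o); have [q hq] := pG o (x - o).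
  have pq : p * q = 0.
    by apply: (poly_eq0_interval e0) => t /he; rewrite hornerM -hp -hq.
  have ex : x = o + 1 *: (x - o) by rewrite scale1r addrC subrK.
  by rewrite {1 2}ex hp hq -hornerM pq horner0.
have [|/existsNP[x Fx]] := pselect (forall x, F x = 0); first by left.
right => y; have [p hp] := pF x (y - x); have [q hq] := pG x (y - x).
have /eqP : p * q = 0.
  by apply: (poly_eq0_interval ltr01) => t _; rewrite hornerM -hp -hq FG.
rewrite mulf_eq0 => /orP[]/eqP z.
  by case: Fx; have := hp 0; rewrite scale0r addr0 z horner0.
by have := hq 1; rewrite scale1r addrC subrK z horner0.
Qed.

End Lines.

Variables (I : finType) (l : I -> affform R 2) (f : I -> 'rV[R]_2).
Hypothesis f0 : forall i, ev (l i) (f i) = 0.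
Hypothesis fpos : forall i k, k != i -> 0 < ev (l k) (f i).
Hypothesis a0 : forall i, (l i).2 != 0.
Hypothesis nr : no_ray l.

(** A polynomial that is nonnegative on a polygon and negative outside
    vanishes on the edges, hence on the lines that they span. *)
Lemma polygon_not_one_polynomial (G : 'rV[R]_2 -> R) : poly_on_lines G ->
  (forall y, in_poly l y <-> 0 <= G y) -> False.
Proof.
move=> pG QG; have [i] : inhabited I.
  apply: contrapT => nI; have d0 : const_mx 1 = 0 :> 'rV[R]_2.
    by apply: (nr (y := 0)) => t _ i; case: nI.
  by move/rowP/(_ 0): d0; rewrite !mxE => /eqP; rewrite oner_eq0.
pose p := perp (l i).2.
have ip y : ev (l i) y = 0 -> in_poly l y -> G y = 0.
  move=> iy /QG Gy; apply/eqP; rewrite eq_le Gy andbT leNgt; apply/negP => Gp.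
  have [e e0 he] := gt0_near (- (l i).2) pG Gp.
  have /ltW/QG/(_ i) : 0 < G (y + e *: - (l i).2) by apply: he; rewrite ltW /=.
  by rewrite evDZ iy add0r dotNr; have := dot_self_gt0 (a0 i); nra.
have [|k|e e0 he] := @affine_ge0_near _ _
    (fun k => ev (l k) (f i)) (fun k => dot (l k).2 p).
- exact: in_poly_edge f0 fpos i.
- have [->|ki] := eqVneq k i; first by rewrite dot_perp.
  by move=> k0; have := fpos ki; rewrite k0 ltxx.
have [q hq] := pG (f i) p.
have q0 : q = 0.
  apply: (poly_eq0_interval e0) => t te; rewrite -hq; apply: ip.
    by rewrite evDZ f0 dot_perp mulr0 addr0.
  by move=> k; rewrite evDZ; exact: he.
have /eqP : p = 0.
  by apply: (nr (y := f i)) => t _; apply/QG; rewrite hq q0 horner0.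
by rewrite perp_eq0 (negPf (a0 i)).
Qed.

(** The facet is given by its chart [y |-> p + y *m B], and [g] points out of
    the described set. So at each point of the facet one of [F], [G] is
    nonpositive, hence zero. *)
Lemma facet_not_two_polynomials n (p g : 'rV[R]_n) (B : 'M[R]_(2, n))
    (F G : 'rV[R]_n -> R) o :
  poly_on_lines F -> poly_on_lines G -> (forall i, 0 < ev (l i) o) ->
  (forall y, in_poly l y <-> 0 <= F (p + y *m B) /\ 0 <= G (p + y *m B)) ->
  (forall y e, 0 < e -> ~ (0 <= F (p + y *m B + e *: g) /\
                           0 <= G (p + y *m B + e *: g))) -> False.
Proof.
move=> pF pG o0 inQ out.
have pl (H : 'rV_n -> R) :
    poly_on_lines H -> poly_on_lines (fun y => H (p + y *m B)).
  move=> pH x d; have [q hq] := pH (p + x *m B) (d *m B); exists q => t.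
  by rewrite -hq mulmxDl scalemxAl addrA.
have zero y : in_poly l y -> F (p + y *m B) * G (p + y *m B) = 0.
  move=> /inQ[]; rewrite le_eqVlt => /predU1P[<-|Fy]; first by rewrite mul0r.
  rewrite le_eqVlt => /predU1P[<-|Gy]; first by rewrite mulr0.
  have [e1 e10 h1] := gt0_near g pF Fy; have [e2 e20 h2] := gt0_near g pG Gy.
  exfalso; apply: (out y (Num.min e1 e2)); first by rewrite lt_min e10.
  have e0 : 0 <= Num.min e1 e2 by rewrite le_min !ltW.
  by split; apply/ltW; [apply: h1|apply: h2]; rewrite e0 ge_min lexx ?orbT.
have [d|z|z] := @vanishing_product _ _ _ o (pl F pF) (pl G pG).
- have [|i oi|e e0 he] := @affine_ge0_near _ _
    (fun k => ev (l k) o) (fun k => dot (l k).2 d).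
  + by move=> i; exact: ltW.
  + by have := o0 i; rewrite oi ltxx.
  by exists e => // t te; apply: zero => i; rewrite evDZ; exact: he.
- apply: (polygon_not_one_polynomial (pl G pG)) => y; rewrite inQ z.
  by split=> [[]|].
apply: (polygon_not_one_polynomial (pl F pF)) => y; rewrite inQ z.
by split=> [[]|].
Qed.

End LowerBound.

(** * Polynomial functions on space *)

Section PolynomialFunctions.
Variable R : realType.
Implicit Types F G : 'rV[R]_3 -> R.

Definition poly_fun F : Prop := exists p : mpoly.mpoly 3 R,
  forall x, F x = mpoly.meval (fun j => x 0 j) p.

Lemma poly_fun_cst a : poly_fun (fun=> a).
Proof. by exists (mpoly.mpolyC 3 a) => x; rewrite mpoly.mevalC. Qed.

Lemma poly_fun_add F G :
  poly_fun F -> poly_fun G -> poly_fun (fun x => F x + G x).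
Proof.
by move=> [p hp] [q hq]; exists (p + q) => x; rewrite mpoly.mevalD hp hq.
Qed.

Lemma poly_fun_mul F G :
  poly_fun F -> poly_fun G -> poly_fun (fun x => F x * G x).
Proof.
by move=> [p hp] [q hq]; exists (p * q) => x; rewrite mpoly.mevalM hp hq.
Qed.

Lemma poly_fun_opp F : poly_fun F -> poly_fun (fun x => - F x).
Proof. by move=> [p hp]; exists (- p) => x; rewrite mpoly.mevalN hp. Qed.

Lemma poly_fun_exp F m : poly_fun F -> poly_fun (fun x => F x ^+ m).
Proof. by move=> [p hp]; exists (p ^+ m) => x; rewrite rmorphXn /= hp. Qed.

Lemma poly_fun_sum (J : Type) (r : seq J) (F : J -> 'rV[R]_3 -> R) :
  (forall j, poly_fun (F j)) -> poly_fun (fun x => \sum_(j <- r) F j x).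
Proof.
move=> hF; elim: r => [|j r IHr].
  by have [p hp] := poly_fun_cst 0; exists p => x; rewrite big_nil -hp.
have [p hp] := poly_fun_add (hF j) IHr.
by exists p => x; rewrite big_cons -hp.
Qed.

Lemma poly_fun_prod (J : Type) (r : seq J) (F : J -> 'rV[R]_3 -> R) :
  (forall j, poly_fun (F j)) -> poly_fun (fun x => \prod_(j <- r) F j x).
Proof.
move=> hF; elim: r => [|j r IHr].
  by have [p hp] := poly_fun_cst 1; exists p => x; rewrite big_nil -hp.
have [p hp] := poly_fun_mul (hF j) IHr.
by exists p => x; rewrite big_cons -hp.
Qed.

Lemma poly_fun_coord n x0 (C : 'M[R]_(3, n)) j :
  poly_fun (fun x => ((x - x0) *m C) 0 j).
Proof.
suff [p hp] : poly_fun (fun x => \sum_k (x 0 k + - x0 0 k) * C k j).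
  by exists p => x; rewrite -hp mxE; apply: eq_bigr => k _; rewrite !mxE.
apply: poly_fun_sum => k; apply: poly_fun_mul (poly_fun_cst _).
apply: poly_fun_add (poly_fun_cst _).
by exists (mpoly.mpolyX R (mpoly.mnm1 k)) => x; rewrite mpoly.mevalXU.
Qed.

Lemma poly_fun_dot n x0 (C : 'M[R]_(3, n)) a :
  poly_fun (fun x => dot a ((x - x0) *m C)).
Proof.
apply: poly_fun_sum => j; apply: poly_fun_mul (poly_fun_cst _) _.
exact: poly_fun_coord.
Qed.

Lemma poly_fun_on_lines F : poly_fun F -> poly_on_lines F.
Proof.
move=> [p hp] x d.
exists (\sum_(m <- mpoly.msupp p) (mpoly.mcoeff m p)%:P *
  \prod_i ((x 0 i)%:P + (d 0 i)%:P * 'X) ^+ mpoly.fun_of_multinom m i) => t.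
rewrite hp mpoly.mevalE horner_sum; apply: eq_bigr => m _.
rewrite hornerM hornerC horner_prod; congr (_ * _); apply: eq_bigr => i _.
by rewrite !hornerE !mxE [t * _]mulrC.
Qed.

Lemma representable3 (P : set 'rV[R]_3) F G H :
  poly_fun F -> poly_fun G -> poly_fun H ->
  (forall x, P x <-> [/\ 0 <= F x, 0 <= G x & 0 <= H x]) ->
  representable 3 P.
Proof.
move=> [p hp] [q hq] [r hr] hP.
exists (fun i : 'I_3 => [:: p; q; r]`_i); apply/seteqP; split=> x.
  by move=> /hP[Fx Gx Hx] [[|[|[|//]]]] i /=; rewrite -?hp -?hq -?hr.
move=> h; apply/hP; split; rewrite ?hp ?hq ?hr.
- exact: (h (@Ordinal 3 0 isT)).
- exact: (h (@Ordinal 3 1 isT)).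
exact: (h (@Ordinal 3 2 isT)).
Qed.

Lemma representable_le2 (P : set 'rV[R]_3) k : (k <= 2)%N ->
  representable k P -> exists F G, [/\ poly_fun F, poly_fun G
    & forall x, P x <-> 0 <= F x /\ 0 <= G x].
Proof.
move=> k2 [p ->].
(* Missing polynomials are replaced by zero, which imposes no condition. *)
pose q n := if insub n is Some i then p i else 0.
pose F n (x : 'rV[R]_3) := mpoly.meval (fun j => x 0 j) (q n).
exists (F 0%N), (F 1%N); split; [by exists (q 0%N)|by exists (q 1%N)|] => x.
split=> [h|[h0 h1]].
  have hq n : 0 <= mpoly.meval (fun j => x 0 j) (q n).
    by rewrite /q; case: insubP => [i _ _|_]; rewrite ?mpoly.meval0.
  by split; exact: hq.
move=> [i ik]; have qi : q i = p (Ordinal ik) by rewrite /q insubT.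
rewrite -qi; have : (i < 2)%N by exact: leq_trans ik k2.
by case: (i) => [|[|]].
Qed.

Lemma m_poly_eq3 (P : set 'rV[R]_3) : representable 3 P ->
  (forall k, (k <= 2)%N -> ~ representable k P) -> m_poly P = 3%N.
Proof.
move=> r3 no; have S3 : representable 3 P /\
    forall k, representable k P -> (3 <= k)%N.
  by split=> // k rk; rewrite ltnNge; apply/negP => k2; exact: no rk.
have [rm mm] : [set n | representable n P /\
    forall k, representable k P -> (n <= k)%N] (m_poly P).
  by apply: xgetPex; exists 3%N.
by apply/eqP; rewrite eqn_leq mm // S3.2.
Qed.

End PolynomialFunctions.

(** * Charts adapted to the base of a prism or pyramid *)

Section Charts.
Variable R : realType.
Implicit Types (P Q : set 'rV[R]_3) (U : 'M[R]_3).

Lemma dot_mulmx m n (a : 'rV[R]_n) (y : 'rV[R]_m) (B : 'M[R]_(m, n)) :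
  dot a (y *m B) = dot (a *m B^T) y.
Proof.
have dE k (b x : 'rV[R]_k) : dot b x = (b *m x^T) 0 0.
  by rewrite mxE; apply: eq_bigr => j _; rewrite !mxE.
by rewrite !dE trmx_mul mulmxA.
Qed.

Lemma sub_affine_hull P x : P x -> affine_hull P x.
Proof.
move=> Px; exists 1%N, (fun=> 1), (fun=> x); split=> //.
  by rewrite big_ord1.
by rewrite big_ord1 scale1r.
Qed.

Lemma sumZB n (c : 'I_n -> R) (x : 'I_n -> 'rV[R]_3) p :
  \sum_i c i = 1 -> \sum_i c i *: x i - p = \sum_i c i *: (x i - p).
Proof.
move=> c1; under [RHS]eq_bigr do rewrite scalerBr.
by rewrite sumrB -scaler_suml c1 scale1r.
Qed.

(** The affine hull of a set of dimension 3 is the whole space. *)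
Lemma dim3_not_in_plane P U p : has_dim 3 P -> \rank U = 2%N ->
  (forall x, P x -> (x - p <= U)%MS) -> False.
Proof.
move=> [p' [U' [rU' aff]]] rU PU.
suff /mxrankS : (1%:M <= U)%MS by rewrite mxrank1 rU.
apply/row_subP => i; set d := row i _.
have : affine_hull P (p + d) by rewrite aff /= submx_full // /row_full rU'.
move=> [n [c [x [Px c1 e]]]].
have -> : d = \sum_i c i *: (x i - p) by rewrite -sumZB // -e addrC addKr.
by apply: summx_sub => k _; apply/scalemx_sub/PU.
Qed.

(** The rows of [B] and [w] form a basis of space; [C] and [c] are the two
    blocks of the inverse basis matrix. *)
Lemma plane_coordinates U (w : 'rV[R]_3) : \rank U = 2%N -> ~~ (w <= U)%MS ->
  exists (B : 'M[R]_(2, 3)) (C : 'M[R]_(3, 2)) (c : 'M[R]_(3, 1)),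
  [/\ forall d : 'rV_3, (d <= U)%MS <-> exists y : 'rV_2, d = y *m B,
      B *m C = 1%:M /\ B *m c = 0, w *m C = 0 /\ w *m c = 1%:M
    & forall x : 'rV_3, x = x *m C *m B + (x *m c) 0 0 *: w].
Proof.
move=> rU wU; pose B : 'M_(2, 3) := castmx (rU, erefl) (row_base U).
have BU : (B :=: U)%MS by apply: (eqmx_trans (eqmx_cast _ _)); exact: eq_row_base.
pose M : 'M[R]_(2 + 1, 3) := col_mx B w.
have Mu : (M : 'M_3) \in unitmx.
  rewrite -row_free_unit /row_free eqn_leq rank_leq_row /=.
  have -> : \rank (M : 'M_3) = \rank (U + w)%MS.
    have [e1 _] := addsmxE B w; have [e2 _] := adds_eqmx BU (eqmx_refl w).
    by rewrite -e2 e1.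
  rewrite -{1}rU.
  rewrite ltn_neqAle mxrankS ?addsmxSl // andbT; apply: contra wU => /eqP e.
  have := mxrank_leqif_sup (addsmxSl U w); rewrite e => -[_].
  by rewrite eqxx => /esym h; apply: submx_trans (addsmxSr U w) _; rewrite h.
pose N : 'M[R]_(3, 2 + 1) := invmx (M : 'M_3).
have MN : M *m N = 1%:M by exact: mulmxV.
have NM : N *m M = 1%:M by exact: mulVmx.
pose C := lsubmx N; pose c := rsubmx N.
have NE : N = row_mx C c by rewrite hsubmxK.
rewrite NE in MN NM.
exists B, C, c; move: MN; rewrite /M mul_col_row.
rewrite [1%:M](scalar_mx_block 2 1) => /eq_block_mx[e1 e2 e3 e4].
split=> //.
  by move=> d; rewrite -BU; split=> [/submxP//|[y ->]]; exact: submxMl.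
move=> x; rewrite -{1}[x]mulmx1 -NM mul_row_col mulmxDr !mulmxA.
by congr (_ + _); apply/rowP => j; rewrite !mxE big_ord1 !mxE.
Qed.

Definition irredundant_polygon (J : finType) (l : J -> affform R 2)
    (f : J -> 'rV[R]_2) (o : 'rV[R]_2) : Prop :=
  [/\ forall j, 0 < ev (l j) o, forall j, ev (l j) (f j) = 0,
      forall j k, k != j -> 0 < ev (l k) (f j),
      forall j, (l j).2 != 0 & no_ray l].

(** In the chart [y |-> p + y *m B] of its plane, the base is a bounded polygon
    with interior points: an affine form that vanishes on the base vanishes on
    its affine hull, which is the whole plane. *)
Lemma base_polygon Q p U (B : 'M[R]_(2, 3)) (C : 'M[R]_(3, 2)) :
  polytope Q -> affine_hull Q = [set x | (x - p <= U)%MS] ->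
  (forall d : 'rV_3, (d <= U)%MS <-> exists y : 'rV_2, d = y *m B) ->
  B *m C = 1%:M ->
  exists (J : finType) (l : J -> affform R 2) f o, irredundant_polygon l f o /\
    forall x, Q x <-> exists y, in_poly l y /\ x = p + y *m B.
Proof.
move=> [bQ [n [H [Hhs QH]]]] affQ UB BC.
have /choice[ab hab] : forall i, exists ab : 'rV[R]_3 * R,
    H i = [set x | dot ab.1 x <= ab.2].
  by move=> i; have [a [b [_ ->]]] := Hhs i; exists (a, b).
pose l i : affform R 2 :=
  ((ab i).2 - dot (ab i).1 p, - ((ab i).1 *m B^T)).
have lE y : Q (p + y *m B) <-> in_poly l y.
  have ev_l i : ev (l i) y = (ab i).2 - dot (ab i).1 (p + y *m B).
    by rewrite /ev /= dotDr dot_mulmx -[- (_ *m _)]scaleN1r dotZl; ring.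
  rewrite QH; split=> h i; first by have := h i I; rewrite hab ev_l subr_ge0.
  by move=> _; have := h i; rewrite hab /= ev_l subr_ge0.
have Qpl x : Q x -> exists y, x = p + y *m B.
  move=> /sub_affine_hull; rewrite affQ /= => /UB[y e].
  by exists y; rewrite -e addrC subrK.
have nr : no_ray l.
  (* A ray in the plane would leave the ball of radius [M + 1]. *)
  move=> y d h; rewrite -[d]mulmx1 -BC mulmxA.
  suff -> : d *m B = 0 by rewrite mul0mx.
  apply/eqP; rewrite -normr_le0 leNgt; apply/negP => dB.
  have [M [_ hM]] := bQ; have {hM} := hM (M + 1); rewrite ltrDl ltr01.
  move=> /(_ isT) hM.
  pose x := p + y *m B.
  have M1 : 0 <= M + 1 by apply: le_trans (hM x _); rewrite ?normr_ge0 //;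
    apply/lE; have := h 0 (lexx 0); rewrite scale0r addr0.
  pose t := (M + 1 + `|x| + 1) / `|d *m B|.
  have t0 : 0 <= t by rewrite divr_ge0 // addr_ge0 // addr_ge0.
  have /hM : Q (x + t *: (d *m B)).
    by rewrite /x -addrA scalemxAl -mulmxDl; apply/lE/h.
  apply/negP; rewrite -ltNge.
  rewrite [x + _]addrC; apply: lt_le_trans (lerB_normD _ _).
  rewrite normrZ (ger0_norm t0) /t divfK ?gt_eqF //.
  by rewrite addrAC addrK ltrDl.
have [y0 Qy0] : exists y, in_poly l y.
  have : affine_hull Q p by rewrite affQ /= subrr sub0mx.
  move=> [[|m] [c [x [Qx c1 _]]]].
    by move: c1; rewrite big_ord0 => /esym/eqP; rewrite oner_eq0.
  by have [y e] := Qpl _ (Qx ord0); exists y; apply/lE; rewrite -e.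
have full (h : affform R 2) : (forall y, in_poly l y -> ev h y = 0) -> h = 0.
  move=> h0; have hy y : ev h y = 0.
    have : affine_hull Q (p + y *m B).
      by rewrite affQ /= addrC addKr; apply/UB; exists y.
    move=> [m [c [x [Qx c1 e]]]].
    have [z hz] := choice (fun i => Qpl _ (Qx i)).
    have ey : y = \sum_i c i *: z i.
      have : y *m B = \sum_i c i *: (z i *m B).
        rewrite -(addKr p (y *m B)) e addrC sumZB //.
        by apply: eq_bigr => i _; rewrite hz addrC addKr.
      move/(congr1 (mulmx^~ C)); rewrite -mulmxA BC mulmx1 => ->.
      rewrite mulmx_suml; apply: eq_bigr => i _.
      by rewrite -scalemxAl -mulmxA BC mulmx1.
    rewrite /ev ey dot_sumr -[h.1]mul1r -c1 mulr_suml -big_split /=.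
    apply: big1 => i _; rewrite dotZr -mulrDr.
    rewrite (_ : _ + _ = ev h (z i)) // h0 ?mulr0 //.
    by apply/lE; rewrite -hz.
  have h1 : h.1 = 0.
    by have := hy 0; rewrite /ev dot0r addr0.
  have h2 : h.2 = 0.
    apply/eqP/negPn/negP => /dot_self_gt0.
    by have := hy h.2; rewrite /ev h1 add0r => ->; rewrite ltxx.
  by case: h h1 h2 {h0 hy} => h1 h2 /= -> ->.
have [o [Qo ho]] := positive_point Qy0 full.
have [J [l' [f [l'l o0 f0 fpos a0]]]] := irredundant_subsystem Qo ho.
exists J, l', f, o; split.
  split=> // y d h; apply: (nr y) => t t0; apply/l'l; exact: h.
move=> x; split=> [Qx|[y [/l'l/lE Qy ->//]]].
by have [y e] := Qpl _ Qx; exists y; split=> //; apply/l'l/lE; rewrite -e.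
Qed.

End Charts.

(** * Prisms and pyramids *)

Section PrismsPyramids.
Variable R : realType.
Implicit Types (P Q : set 'rV[R]_3).

Lemma convex_hull_pair P (x y : 'rV[R]_3) s : 0 <= s <= 1 -> P x -> P y ->
  convex_hull P ((1 - s) *: x + s *: y).
Proof.
move=> /andP[s0 s1] Px Py.
exists 2%N, (fun i : 'I_2 => if i == 0 then 1 - s else s),
  (fun i : 'I_2 => if i == 0 then x else y); split.
- by move=> i; case: ifP.
- by move=> i; case: ifP => _ //; rewrite subr_ge0.
- by rewrite big_ord_recl big_ord1 /= subrK.
- by rewrite big_ord_recl big_ord1.
Qed.

Lemma convex_hull_segment (v x : 'rV[R]_3) :
  convex_hull [set 0; v] x <-> exists s : R, 0 <= s <= 1 /\ x = s *: v.
Proof.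
split=> [[n [c [y [hy c0 c1 ->]]]]|[s [s01 ->]]]; last first.
  have -> : s *: v = (1 - s) *: 0 + s *: v by rewrite scaler0 add0r.
  by apply: convex_hull_pair => //; [left|right].
have /choice[e he] : forall i, exists e : R, 0 <= e <= 1 /\ y i = e *: v.
  move=> i; case: (hy i) => ->; last by exists 1; rewrite scale1r lexx ler01.
  by exists 0; rewrite scale0r lexx ler01.
exists (\sum_i c i * e i); split; last first.
  rewrite scaler_suml; apply: eq_bigr => i _.
  by have [_ ->] := he i; rewrite scalerA.
rewrite sumr_ge0 => [|i _] /=; last first.
  by have [/andP[e0 _] _] := he i; rewrite mulr_ge0.
rewrite -c1; apply: ler_sum => i _.
by have [/andP[_ e1] _] := he i; rewrite ler_piMr.
Qed.

Lemma unit_interval_quadratic (s : R) : (0 <= s <= 1) = (0 <= s * (1 - s)).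
Proof.
apply/idP/idP => [/andP[s0 s1]|h]; first by rewrite mulr_ge0 // subr_ge0.
by apply/andP; split; nra.
Qed.

Lemma not_representable_le2 P (p g : 'rV[R]_3) (B : 'M[R]_(2, 3)) (J : finType)
    (l : J -> affform R 2) f o : irredundant_polygon l f o ->
  (forall y, P (p + y *m B) <-> in_poly l y) ->
  (forall y e, 0 < e -> ~ P (p + y *m B + e *: g)) ->
  forall k, (k <= 2)%N -> ~ representable k P.
Proof.
move=> [o0 f0 fpos a0 nr] inP outP k k2.
move=> /(representable_le2 k2)[F [G [pF pG hP]]].
apply: (facet_not_two_polynomials (p := p) (g := g) (B := B) f0 fpos a0 nr
  (poly_fun_on_lines pF) (poly_fun_on_lines pG) o0).
- by move=> y; rewrite -inP hP.
by move=> y e e0 /hP; exact: outP.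
Qed.

(** The chart [Y] is the projection to the plane of the base along the direction
    [v] of the prism, and [h] is the height above this plane. *)
Lemma m_poly_prism P : has_dim 3 P -> prism P -> m_poly P = 3%N.
Proof.
move=> dimP [Q [v [[pQ [p [U [rU affQ]]]] PQ]]].
have hP x : P x <-> exists q (s : R), [/\ Q q, 0 <= s <= 1 & x = q + s *: v].
  rewrite PQ; split.
    by move=> [q Qq [_ /convex_hull_segment[s [s01 ->]] <-]]; exists q, s.
  move=> [q [s [Qq s01 ->]]]; exists q => //; exists (s *: v) => //.
  by apply/convex_hull_segment; exists s.
have vU : ~~ (v <= U)%MS.
  apply/negP => vU; apply: (dim3_not_in_plane (p := p) dimP rU) => x.
  move=> /hP[q [s [/sub_affine_hull + _ ->]]]; rewrite affQ /= => qU.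
  by rewrite addrAC addmx_sub // scalemx_sub.
have [B [C [c [UB [BC Bc] [vC vc] xE]]]] := plane_coordinates rU vU.
have [J [l [f [o [lP hQ]]]]] := base_polygon pQ affQ UB BC.
pose Y (x : 'rV[R]_3) := (x - p) *m C.
pose h (x : 'rV[R]_3) := ((x - p) *m c) 0 0.
have Yh y s : Y (p + y *m B + s *: v) = y /\ h (p + y *m B + s *: v) = s.
  have e : p + y *m B + s *: v - p = y *m B + s *: v.
    by apply/rowP => j; rewrite !mxE; ring.
  rewrite /Y /h e !mulmxDl -!mulmxA -!scalemxAl BC Bc vC vc.
  rewrite scaler0 addr0 mulmx1 mulmx0 add0r; split=> //.
  by rewrite !mxE eqxx mulr1.
have hP' x : P x <-> in_poly l (Y x) /\ 0 <= h x <= 1.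
  split=> [/hP[q [s [/hQ[y [ly ->]] s01 ->]]]|[ly hx]].
    by have [-> ->] := Yh y s.
  apply/hP; exists (p + Y x *m B), (h x); split=> //.
    by apply/hQ; exists (Y x).
  by rewrite -addrA -xE addrC subrK.
apply: m_poly_eq3; last first.
  apply: (not_representable_le2 (p := p) (g := - v) (B := B) lP).
    move=> y; rewrite hP'; have [] := Yh y 0; rewrite scale0r addr0 => -> ->.
    by rewrite lexx ler01; split=> [[]|].
  move=> y e e0 /hP'; rewrite scalerN -scaleNr; have [_ ->] := Yh y (- e).
  by move=> [_ /andP[]]; rewrite oppr_ge0 leNgt e0.
have [o0 f0 fpos a0 nr] := lP.
have [n [m [u [lam [lam0 uP _]]]]] := polygon_two_polynomials f0 fpos a0 nr.
have pform (k : affform R 2) : poly_fun (fun x => ev k (Y x)).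
  exact: poly_fun_add (poly_fun_cst _) (poly_fun_dot _ _ _).
apply: (@representable3 _ _ (fun x => \prod_i ev (l i) (Y x))
  (fun x => 1 + - \sum_j lam j * ev (u j) (Y x) ^+ (2 ^ m.+1))
  (fun x => h x * (1 + - h x))).
- exact: poly_fun_prod.
- apply: poly_fun_add (poly_fun_cst _) (poly_fun_opp _).
  apply: poly_fun_sum => j; apply: poly_fun_mul (poly_fun_cst _) _.
  exact: poly_fun_exp.
- have ph : poly_fun h by exact: poly_fun_coord.
  apply: (poly_fun_mul ph).
  exact: (poly_fun_add (poly_fun_cst _) (poly_fun_opp ph)).
move=> x; rewrite hP' uP subr_ge0 unit_interval_quadratic.
by split=> [[[]]|[]].
Qed.

(** The origin of the chart is the apex, and the base lies at height 1. So at
    height [h > 0] the inequalities of the pyramid are those of the base at the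
    point [Y / h], multiplied by powers of [h]. At height 0 the definiteness of
    the vertex forms leaves only the apex. *)
Lemma m_poly_pyramid P : has_dim 3 P -> pyramid P -> m_poly P = 3%N.
Proof.
move=> dimP [Q [v [[pQ [p [U [rU affQ]]]] PQ]]].
have vU : ~~ (p - v <= U)%MS.
  apply/negP => vU; apply: (dim3_not_in_plane (p := p) dimP rU) => x.
  rewrite PQ => -[n [c [y [hy _ c1 ->]]]]; rewrite sumZB //.
  apply: summx_sub => i _; apply: scalemx_sub.
  case: (hy i) => [/sub_affine_hull|/= ->]; first by rewrite affQ.
  by rewrite -opprB eqmx_opp.
have [B [C [c [UB [BC Bc] [wC wc] xE]]]] := plane_coordinates rU vU.
have [J [l [f [o [lP hQ]]]]] := base_polygon pQ affQ UB BC.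
have [o0 f0 fpos a0 nr] := lP.
pose Y (x : 'rV[R]_3) := (x - v) *m C.
pose h (x : 'rV[R]_3) := ((x - v) *m c) 0 0.
pose hom (k : affform R 2) x := k.1 * h x + dot k.2 (Y x).
have hom_ev k x : h x != 0 -> hom k x = h x * ev k ((h x)^-1 *: Y x).
  by move=> hx; rewrite /hom /ev dotZr; field.
have xvE x : x = v + (Y x *m B + h x *: (p - v)) by rewrite -xE addrC subrK.
have Yh y s : Y (p + y *m B + s *: (p - v)) = y /\
    h (p + y *m B + s *: (p - v)) = 1 + s.
  have e : p + y *m B + s *: (p - v) - v = y *m B + (1 + s) *: (p - v).
    by apply/rowP => j; rewrite !mxE; ring.
  rewrite /Y /h e !mulmxDl -!mulmxA -!scalemxAl BC Bc wC wc.
  rewrite scaler0 addr0 mulmx1 mulmx0 add0r; split=> //.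
  by rewrite !mxE eqxx mulr1.
have Yh1 y : Y (p + y *m B) = y /\ h (p + y *m B) = 1.
  by have := Yh y 0; rewrite scale0r !addr0.
have apex x : h x = 0 -> Y x = 0 -> x = v.
  by move=> hx Yx; rewrite [x]xvE hx Yx mul0mx scale0r !addr0.
have hP x : P x <-> 0 <= h x <= 1 /\ forall i, 0 <= hom (l i) x.
  split.
    rewrite PQ => -[n [a [y [hy a0' a1 ex]]]].
    have yP i : 0 <= h (y i) <= 1 /\ forall j, 0 <= hom (l j) (y i).
      case: (hy i) => [/hQ[z [lz ->]]|/= ->].
        have [Yz hz] := Yh1 z; rewrite hz ler01 lexx; split=> // j.
        by rewrite /hom Yz hz mulr1; exact: lz.
      rewrite /hom /h /Y subrr !mul0mx mxE lexx ler01; split=> // j.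
      by rewrite mulr0 add0r dot0r.
    have eh : h x = \sum_i a i * h (y i).
      rewrite /h ex sumZB // mulmx_suml summxE; apply: eq_bigr => i _.
      by rewrite -scalemxAl mxE.
    have eY : Y x = \sum_i a i *: Y (y i).
      rewrite /Y ex sumZB // mulmx_suml; apply: eq_bigr => i _.
      by rewrite -scalemxAl.
    split.
      rewrite eh sumr_ge0 => [|i _] /=; last first.
        by have [/andP[h0 _] _] := yP i; rewrite mulr_ge0.
      rewrite -a1; apply: ler_sum => i _.
      by have [/andP[_ h1] _] := yP i; rewrite ler_piMr.
    move=> j; have -> : hom (l j) x = \sum_i a i * hom (l j) (y i).
      rewrite /hom eh eY dot_sumr mulr_sumr -big_split; apply: eq_bigr => i _.
      by rewrite /= dotZr; ring.
    by apply: sumr_ge0 => i _; have [_ /(_ j)] := yP i; exact: (mulr_ge0 (a0' i)).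
  move=> [h01 hx]; have [hx0|hx0] := eqVneq (h x) 0.
    have Y0 : Y x = 0.
      apply: (nr o) => t t0 i; rewrite evDZ; apply: addr_ge0; first exact: ltW.
      by have := hx i; rewrite /hom hx0 mulr0 add0r; exact: (mulr_ge0 t0).
    rewrite (apex x) // PQ.
    have := @convex_hull_pair (Q `|` [set v]) v v 0.
    by rewrite subr0 scale1r scale0r addr0 lexx ler01; apply=> //; right.
  have hp : 0 < h x by rewrite lt_def hx0; case/andP: h01.
  rewrite PQ; have -> : x = (1 - h x) *: v +
      h x *: (p + ((h x)^-1 *: Y x) *m B).
    have -> : h x *: (p + ((h x)^-1 *: Y x) *m B) = h x *: p + Y x *m B.
      by rewrite scalerDr -scalemxAl scalerA divff // scale1r.
    rewrite {1}[x]xvE.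
    by apply/rowP => j; rewrite !mxE; ring.
  apply: convex_hull_pair => //; [by right|left].
  apply/hQ; exists ((h x)^-1 *: Y x); split=> // i.
  by have := hx i; rewrite hom_ev // pmulr_rge0.
apply: m_poly_eq3; last first.
  apply: (not_representable_le2 (p := p) (g := p - v) (B := B) lP).
    move=> y; rewrite hP; have [Yy hy] := Yh1 y; rewrite hy ler01 lexx.
    have hE i : hom (l i) (p + y *m B) = ev (l i) y by rewrite /hom Yy hy mulr1.
    split=> [[_ hl] i|ly]; first by rewrite -hE.
    by split=> // i; rewrite hE; exact: ly.
  move=> y e e0 /hP[+ _]; have [_ ->] := Yh y e.
  by move=> /andP[_]; rewrite gerDl leNgt e0.
have [n [m [u [lam [lam0 uP udef]]]]] := polygon_two_polynomials f0 fpos a0 nr.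
have ph : poly_fun h by exact: poly_fun_coord.
have phom (k : affform R 2) : poly_fun (hom k).
  apply: poly_fun_add (poly_fun_dot _ _ _).
  exact: poly_fun_mul (poly_fun_cst _) ph.
apply: (@representable3 _ _ (fun x => \prod_i hom (l i) x)
  (fun x => h x ^+ (2 ^ m.+1) + - \sum_j lam j * hom (u j) x ^+ (2 ^ m.+1))
  (fun x => h x * (1 + - h x))).
- exact: poly_fun_prod.
- apply: poly_fun_add (poly_fun_exp _ ph) (poly_fun_opp _).
  apply: poly_fun_sum => j; apply: poly_fun_mul (poly_fun_cst _) _.
  exact: poly_fun_exp.
- apply: (poly_fun_mul ph).
  exact: (poly_fun_add (poly_fun_cst _) (poly_fun_opp ph)).
move=> x; rewrite hP subr_ge0.
suff E : 0 <= h x <= 1 -> ((forall i, 0 <= hom (l i) x) <->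
    0 <= \prod_i hom (l i) x /\
    \sum_j lam j * hom (u j) x ^+ (2 ^ m.+1) <= h x ^+ (2 ^ m.+1)).
  rewrite -unit_interval_quadratic.
  by split=> [[h01 /(E h01)[]]|[? ? h01]]; split=> //; apply/(E h01).
move=> h01; have [hx0|hx0] := eqVneq (h x) 0.
  have N0 : (0 : R) ^+ (2 ^ m.+1) = 0 by rewrite expr0n expn_eq0.
  have homE k : hom k x = dot k.2 (Y x) by rewrite /hom hx0 mulr0 add0r.
  have zero : Y x = 0 -> forall k, hom k x = 0.
    by move=> Y0 k; rewrite homE Y0 dot0r.
  rewrite hx0 N0; split=> [hx|[_ hs] i].
    have Y0 : Y x = 0.
      apply: (nr o) => t t0 i; rewrite evDZ -homE; apply: addr_ge0; first exact: ltW.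
      exact: mulr_ge0.
    split; first by apply: prodr_ge0.
    by rewrite big1 // => j _; rewrite zero // N0 mulr0.
  rewrite zero //; apply: udef => j.
  have ge0 k : true -> 0 <= lam k * hom (u k) x ^+ (2 ^ m.+1).
    by move=> _; rewrite mulr_ge0 ?exp_pow2_ge0 // ltW.
  have : \sum_j lam j * hom (u j) x ^+ (2 ^ m.+1) = 0.
    by apply/eqP; rewrite eq_le hs sumr_ge0.
  move=> /eqP; rewrite psumr_eq0 // => /allP/(_ j (mem_index_enum _)) /=.
  by rewrite mulf_eq0 gt_eqF //= expf_eq0 -homE => /andP[_ /eqP].
have hp : 0 < h x by rewrite lt_def hx0; case/andP: h01.
pose y := (h x)^-1 *: Y x.
have -> : (forall i, 0 <= hom (l i) x) <-> in_poly l y.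
  by split=> hl i; have := hl i; rewrite hom_ev // pmulr_rge0.
have -> : \prod_i hom (l i) x = h x ^+ #|J| * \prod_i ev (l i) y.
  by rewrite -prodr_const -big_split; apply: eq_bigr => i _; rewrite hom_ev.
have -> : \sum_j lam j * hom (u j) x ^+ (2 ^ m.+1) =
    h x ^+ (2 ^ m.+1) * \sum_j lam j * ev (u j) y ^+ (2 ^ m.+1).
  by rewrite mulr_sumr; apply: eq_bigr => j _; rewrite hom_ev // exprMn mulrCA.
rewrite uP pmulr_rge0 ?exprn_gt0 //.
by rewrite ger_pMr ?exprn_gt0.
Qed.

End PrismsPyramids.

Theorem corollary2p4 (R : realType) (P : set 'rV[R]_3)
    (hP : polytope_of_dim 3 P) (hpp : prism P \/ pyramid P) :
  m_poly P = 3%N.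
Proof.
have [_ dimP] := hP.
by case: hpp => h; [exact: m_poly_prism|exact: m_poly_pyramid].
Qed.
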